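(* Let $(\mathfrak g,[\cdot,\cdot]_{\mathfrak g},s_{\mathfrak g})$ and $(\mathfrak k,[\cdot,\cdot]_{\mathfrak k},s_{\mathfrak k})$ be two Lie superalgebras over a field of characteristic $2$, endowed with - representations of Lie algebras $\pi:\mathfrak g_{\bar 0}\to\mathrm{End}(\mathfrak k_{\bar 0})$, $\lambda:\mathfrak g_{\bar 0}\to\mathrm{End}(\mathfrak k_{\bar 1})$, $\rho:\mathfrak k_{\bar 0}\to\mathrm{End}(\mathfrak g_{\bar 0})$, $\mu:\mathfrak k_{\bar 0}\to\mathrm{End}(\mathfrak g_{\bar 1})$; - linear maps $\tilde\lambda:\mathfrak g_{\bar 0}\to\mathrm{Hom}(\mathfrak k_{\bar 1},\mathfrak g_{\bar 1})$ and $\tilde\mu:\mathfrak k_{\bar 0}\to\mathrm{Hom}(\mathfrak g_{\bar 1},\mathfrak k_{\bar 1})$; - bilinear maps $r_{\mathfrak g}:\mathfrak g_{\bar 1}\odot\mathfrak k_{\bar 1}\to\mathfrak g_{\bar 0}$ and $r_{\mathfrak k}:\mathfrak g_{\bar 1}\odot\mathfrak k_{\bar 1}\to\mathfrak k_{\bar 0}$, such that conditions (A)–(F) listed in the context hold. Then there exists a Lie superalgebra structure on $\mathfrak h:=\mathfrak g\oplus\mathfrak k$ given as follows. The Lie bracket on $\mathfrak h_{\bar 0}$: for $x_0,y_0\in\mathfrak g_{\bar 0}$, $a_0,b_0\in\mathfrak k_{\bar 0}$, $$[x_0+a_0,y_0+b_0]_{\mathfrak h}:=[x_0,y_0]_{\mathfrak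 g}+\rho(b_0)(x_0)+\rho(a_0)(y_0)+[a_0,b_0]_{\mathfrak k}+\pi(x_0)(b_0)+\pi(y_0)(a_0).$$ The $\mathfrak h_{\bar 0}$-module structure on $\mathfrak h_{\bar 1}$: for $x_0\in\mathfrak g_{\bar 0}$, $x_1\in\mathfrak g_{\bar 1}$, $a_0\in\mathfrak k_{\bar 0}$, $a_1\in\mathfrak k_{\bar 1}$, $$[x_0+a_0,x_1+a_1]_{\mathfrak h}:=[x_0,x_1]_{\mathfrak g}+\mu(a_0)(x_1)+\tilde\lambda(x_0)(a_1)+[a_0,a_1]_{\mathfrak k}+\lambda(x_0)(a_1)+\tilde\mu(a_0)(x_1).$$ The squaring on $\mathfrak h_{\bar 1}$: for $x_1\in\mathfrak g_{\bar 1}$, $a_1\in\mathfrak k_{\bar 1}$, $$S_{\mathfrak h}(x_1+a_1):=s_{\mathfrak g}(x_1)+s_{\mathfrak k}(a_1)+r_{\mathfrak g}(x_1,a_1)+r_{\mathfrak k}(x_1,a_1).$$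
   Context: A Lie superalgebra in characteristic $2$ is a superspace $\mathfrak g=\mathfrak g_{\bar 0}\oplus\mathfrak g_{\bar 1}$ such that $\mathfrak g_{\bar 0}$ is a Lie algebra, $\mathfrak g_{\bar 1}$ is a $\mathfrak g_{\bar 0}$-module made two-sided by symmetry, together with a squaring $s_{\mathfrak g}:\mathfrak g_{\bar 1}\to\mathfrak g_{\bar 0}$ with $s_{\mathfrak g}(\lambda x)=\lambda^2 s_{\mathfrak g}(x)$ such that $[x,y]_{\mathfrak g}:=s_{\mathfrak g}(x+y)-s_{\mathfrak g}(x)-s_{\mathfrak g}(y)$ is bilinear on $\mathfrak g_{\bar 1}$ (this is the bracket of odd elements), and $[s_{\mathfrak g}(x),y]_{\mathfrak g}=[x,[x,y]_{\mathfrak g}]_{\mathfrak g}$ for all $x\in\mathfrak g_{\bar 1}$, $y\in\mathfrak g$. The maps $r_{\mathfrak g},r_{\mathfrak k}$ are bilinear on pairs consisting of one element of $\mathfrak g_{\bar 1}$ and one of $\mathfrak k_{\bar 1}$, with the convention $r(x_1,a_1)=r(a_1,x_1)$. Conditions. (A) For all $x_0,y_0\in\mathfrak g_{\bar 0}$, $a_0,b_0\in\mathfrak k_{\bar 0}$: $$\rho(a_0)([x_0,y_0]_{\mathfrak g})+[\rho(a_0)(x_0),y_0]_{\mathfrak g}+[x_0,\rho(a_0)(y_0)]_{\mathfrak g}=\rho(\pi(y_0)(a_0))(x_0)+\rho(\pi(x_0)(a_0))(y_0),$$ $$\pi(x_0)([a_0,b_0]_{\mathfrak k})+[\pi(x_0)(a_0),b_0]_{\mathfrak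 k}+[a_0,\pi(x_0)(b_0)]_{\mathfrak k}=\pi(\rho(b_0)(x_0))(a_0)+\pi(\rho(a_0)(x_0))(b_0).$$ (B) For all $x_0,y_0\in\mathfrak g_{\bar 0}$, $x_1\in\mathfrak g_{\bar 1}$, $a_0,b_0\in\mathfrak k_{\bar 0}$, $a_1\in\mathfrak k_{\bar 1}$: $$\mu(b_0)([x_0,x_1]_{\mathfrak g})+[x_0,\mu(b_0)(x_1)]_{\mathfrak g}=[\rho(b_0)(x_0),x_1]_{\mathfrak g}+\mu(\pi(x_0)(b_0))(x_1)+\tilde\lambda(x_0)(\tilde\mu(b_0)(x_1)),$$ $$\lambda(x_0)([b_0,a_1]_{\mathfrak k})+[b_0,\lambda(x_0)(a_1)]_{\mathfrak k}=[\pi(x_0)(b_0),a_1]_{\mathfrak k}+\lambda(\rho(b_0)(x_0))(a_1)+\tilde\mu(b_0)(\tilde\lambda(x_0)(a_1)),$$ $$\tilde\lambda(\rho(b_0)(x_0))(a_1)+\tilde\lambda(x_0)([b_0,a_1]_{\mathfrak k})=\mu(b_0)(\tilde\lambda(x_0)(a_1)),$$ $$\tilde\mu(\pi(x_0)(b_0))(x_1)+\tilde\mu(b_0)([x_0,x_1]_{\mathfrak g})=\lambda(x_0)(\tilde\mu(b_0)(x_1)),$$ $$\tilde\lambda([x_0,y_0]_{\mathfrak g})(a_1)+[x_0,\tilde\lambda(y_0)(a_1)]_{\mathfrak g}=[y_0,\tilde\lambda(x_0)(a_1)]_{\mathfrak g}+\tilde\lambda(x_0)\lambda(y_0)(a_1)+\tilde\lambda(y_0)\lambda(x_0)(a_1),$$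 $$\tilde\mu([a_0,b_0]_{\mathfrak k})(x_1)+[a_0,\tilde\mu(b_0)(x_1)]_{\mathfrak k}=[b_0,\tilde\mu(a_0)(x_1)]_{\mathfrak k}+\tilde\mu(a_0)\mu(b_0)(x_1)+\tilde\mu(b_0)\mu(a_0)(x_1).$$ (C) For all $x_1\in\mathfrak g_{\bar 1}$, $a_1\in\mathfrak k_{\bar 1}$, $y\in\mathfrak g_{\bar 0}$, $b\in\mathfrak k_{\bar 0}$: $$[r_{\mathfrak g}(x_1,a_1),y]_{\mathfrak g}+\rho(r_{\mathfrak k}(x_1,a_1))(y)=r_{\mathfrak g}(x_1,\lambda(y)(a_1))+[x_1,\tilde\lambda(y)(a_1)]_{\mathfrak g}+r_{\mathfrak g}(a_1,[x_1,y]_{\mathfrak g}),$$ $$\rho(b)(r_{\mathfrak g}(x_1,a_1))+r_{\mathfrak g}(a_1,\mu(b)(x_1))=r_{\mathfrak g}(x_1,[a_1,b]_{\mathfrak k}),$$ $$\rho(b)(s_{\mathfrak g}(x_1))+[x_1,\mu(b)(x_1)]_{\mathfrak g}=r_{\mathfrak g}(x_1,\tilde\mu(b)(x_1)),\qquad \rho(s_{\mathfrak k}(a_1))(y)=r_{\mathfrak g}(a_1,\tilde\lambda(y)(a_1)).$$ (D) For the same elements: $$[r_{\mathfrak k}(x_1,a_1),b]_{\mathfrak k}+\pi(r_{\mathfrak g}(x_1,a_1))(b)=r_{\mathfrak k}(a_1,\mu(b)(x_1))+[a_1,\tilde\mu(b)(x_1)]_{\mathfrak k}+r_{\mathfrak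 k}(x_1,[a_1,b]_{\mathfrak k}),$$ $$\pi(y)(r_{\mathfrak k}(x_1,a_1))+r_{\mathfrak k}(x_1,\lambda(y)(a_1))=r_{\mathfrak k}(a_1,[x_1,y]_{\mathfrak g}),$$ $$\pi(y)(s_{\mathfrak k}(a_1))+[a_1,\lambda(y)(a_1)]_{\mathfrak k}=r_{\mathfrak k}(a_1,\tilde\lambda(y)(a_1)),\qquad \pi(s_{\mathfrak g}(x_1))(b)=r_{\mathfrak k}(x_1,\tilde\mu(b)(x_1)).$$ (E) For all $x_1,y\in\mathfrak g_{\bar 1}$, $a_1,b\in\mathfrak k_{\bar 1}$: $$\tilde\mu(r_{\mathfrak k}(x_1,a_1))(y)=\lambda([x_1,y]_{\mathfrak g})(a_1)+\tilde\mu(r_{\mathfrak k}(a_1,y))(x_1),$$ $$\tilde\mu(s_{\mathfrak k}(a_1))(y)=[r_{\mathfrak k}(a_1,y),a_1]_{\mathfrak k}+\lambda(r_{\mathfrak g}(a_1,y))(a_1),\qquad \lambda(s_{\mathfrak g}(x_1))(b)=\tilde\mu(r_{\mathfrak k}(x_1,b))(x_1),$$ $$\lambda(r_{\mathfrak g}(x_1,a_1))(b)=[r_{\mathfrak k}(x_1,a_1),b]_{\mathfrak k}+\lambda(r_{\mathfrak g}(x_1,b))(a_1)+\tilde\mu([a_1,b]_{\mathfrak k})(x_1)+[r_{\mathfrak k}(x_1,b),a_1]_{\mathfrak k}.$$ (F) For all $x_1,y\in\mathfrak g_{\bar 1}$, $a_1,b\in\mathfrak k_{\bar 1}$: $$\tilde\lambda(r_{\mathfrak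 g}(x_1,a_1))(b)=\mu([a_1,b]_{\mathfrak k})(x_1)+\tilde\lambda(r_{\mathfrak g}(x_1,b))(a_1),$$ $$\tilde\lambda(s_{\mathfrak g}(x_1))(b)=[r_{\mathfrak g}(x_1,b),x_1]_{\mathfrak g}+\mu(r_{\mathfrak k}(x_1,b))(x_1),\qquad \mu(s_{\mathfrak k}(a_1))(y)=\tilde\lambda(r_{\mathfrak g}(a_1,y))(a_1),$$ $$\mu(r_{\mathfrak k}(x_1,a_1))(y)=[r_{\mathfrak g}(x_1,a_1),y]_{\mathfrak g}+\mu(r_{\mathfrak k}(a_1,y))(x_1)+\tilde\lambda([x_1,y]_{\mathfrak g})(a_1)+[r_{\mathfrak g}(a_1,y),x_1]_{\mathfrak g}.$$ *)

(* Defs.v *)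
From HB Require Import structures.
From mathcomp Require Import all_boot all_order all_algebra.

Set Implicit Arguments.
Unset Strict Implicit.
Unset Printing Implicit Defensive.

Import GRing.Theory.
Local Open Scope ring_scope.

(* A representation of the Lie algebra (V, b) on M, given in uncurried form
   phi x m := phi(x)(m). *)
Definition lie_repr (V M : zmodType) (b : V -> V -> V) (phi : V -> M -> M) :
    Prop :=
  forall x y m, phi (b x y) m = phi x (phi y m) - phi y (phi x m).

Definition polar (V W : zmodType) (s : V -> W) (x y : V) : W :=
  s (x + y) - s x - s y.

(* Lie superalgebra structures, in the characteristic 2 sense, on the
   superspace with even part V0 and odd part V1.  The field is required to have
   characteristic 2 where the structure is used, not here.
   [polar lsa_sq] is the bracket of two odd elements, and the last two fields are
   [s(x), y] = [x, [x, y]] for y even and for y odd, where the bracket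
   [odd, even] is the action read from right to left. *)
Record lie_superalgebra2 (K : fieldType) (V0 V1 : lmodType K) :=
    LieSuperalgebra2 {
  lsa_bracket : {bilinear V0 -> V0 -> V0};
  lsa_act : {bilinear V0 -> V1 -> V1};
  lsa_sq : V1 -> V0;
  lsa_bracket_alt : forall x, lsa_bracket x x = 0;
  lsa_bracket_jacobi : forall x y z,
    lsa_bracket x (lsa_bracket y z) + lsa_bracket y (lsa_bracket z x)
      + lsa_bracket z (lsa_bracket x y) = 0;
  lsa_act_repr : lie_repr lsa_bracket lsa_act;
  lsa_sqZ : forall (c : K) x, lsa_sq (c *: x) = c ^+ 2 *: lsa_sq x;
  lsa_polar_bilinear : bilinear_for *:%R *:%R (polar lsa_sq);
  lsa_sq_even : forall x y,
    lsa_bracket (lsa_sq x) y = polar lsa_sq x (lsa_act y x);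
  lsa_sq_odd : forall x y,
    lsa_act (lsa_sq x) y = lsa_act (polar lsa_sq x y) x
}.

Section Brackets.
Context (K : fieldType) (V0 V1 : lmodType K) (g : lie_superalgebra2 V0 V1).

(* The indices are the parities of the two arguments. *)
Definition br00 (x y : V0) : V0 := lsa_bracket g x y.
Definition br01 (x : V0) (y : V1) : V1 := lsa_act g x y.
Definition br10 (x : V1) (y : V0) : V1 := lsa_act g y x.
Definition br11 (x y : V1) : V0 := polar (lsa_sq g) x y.
Definition sq (x : V1) : V0 := lsa_sq g x.

End Brackets.

(* Throughout, phi(x)(m) is written phi x m, and both r(x1, a1) and r(a1, x1),
   for x1 odd in g and a1 odd in k, are written r x1 a1. *)
Section Conditions.
Context (K : fieldType) (g0 g1 k0 k1 : lmodType K).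
Context (g : lie_superalgebra2 g0 g1) (k : lie_superalgebra2 k0 k1).
Context (pi : {bilinear g0 -> k0 -> k0}) (lam : {bilinear g0 -> k1 -> k1}).
Context (rho : {bilinear k0 -> g0 -> g0}) (mu : {bilinear k0 -> g1 -> g1}).
Context (lamt : {bilinear g0 -> k1 -> g1}) (mut : {bilinear k0 -> g1 -> k1}).
Context (rg : {bilinear g1 -> k1 -> g0}) (rk : {bilinear g1 -> k1 -> k0}).

Definition condA : Prop :=
  (forall (x0 y0 : g0) (a0 : k0),
     rho a0 (br00 g x0 y0) + br00 g (rho a0 x0) y0 + br00 g x0 (rho a0 y0)
     = rho (pi y0 a0) x0 + rho (pi x0 a0) y0) /\
  (forall (x0 : g0) (a0 b0 : k0),
     pi x0 (br00 k a0 b0) + br00 k (pi x0 a0) b0 + br00 k a0 (pi x0 b0)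
     = pi (rho b0 x0) a0 + pi (rho a0 x0) b0).

Definition condB : Prop :=
  [/\ forall (x0 : g0) (b0 : k0) (x1 : g1),
        mu b0 (br01 g x0 x1) + br01 g x0 (mu b0 x1)
        = br01 g (rho b0 x0) x1 + mu (pi x0 b0) x1 + lamt x0 (mut b0 x1),
      forall (x0 : g0) (b0 : k0) (a1 : k1),
        lam x0 (br01 k b0 a1) + br01 k b0 (lam x0 a1)
        = br01 k (pi x0 b0) a1 + lam (rho b0 x0) a1 + mut b0 (lamt x0 a1)
    & [/\ forall (x0 : g0) (b0 : k0) (a1 : k1),
            lamt (rho b0 x0) a1 + lamt x0 (br01 k b0 a1) = mu b0 (lamt x0 a1),
          forall (x0 : g0) (b0 : k0) (x1 : g1),
            mut (pi x0 b0) x1 + mut b0 (br01 g x0 x1) = lam x0 (mut b0 x1),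
          forall (x0 y0 : g0) (a1 : k1),
            lamt (br00 g x0 y0) a1 + br01 g x0 (lamt y0 a1)
            = br01 g y0 (lamt x0 a1) + lamt x0 (lam y0 a1)
              + lamt y0 (lam x0 a1)
        & forall (a0 b0 : k0) (x1 : g1),
            mut (br00 k a0 b0) x1 + br01 k a0 (mut b0 x1)
            = br01 k b0 (mut a0 x1) + mut a0 (mu b0 x1) + mut b0 (mu a0 x1)]].

Definition condC : Prop :=
  [/\ forall (x1 : g1) (a1 : k1) (y : g0),
        br00 g (rg x1 a1) y + rho (rk x1 a1) y
        = rg x1 (lam y a1) + br11 g x1 (lamt y a1) + rg (br10 g x1 y) a1,
      forall (x1 : g1) (a1 : k1) (b : k0),
        rho b (rg x1 a1) + rg (mu b x1) a1 = rg x1 (br10 k a1 b),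
      forall (x1 : g1) (b : k0),
        rho b (sq g x1) + br11 g x1 (mu b x1) = rg x1 (mut b x1)
    & forall (a1 : k1) (y : g0),
        rho (sq k a1) y = rg (lamt y a1) a1].

Definition condD : Prop :=
  [/\ forall (x1 : g1) (a1 : k1) (b : k0),
        br00 k (rk x1 a1) b + pi (rg x1 a1) b
        = rk (mu b x1) a1 + br11 k a1 (mut b x1) + rk x1 (br10 k a1 b),
      forall (x1 : g1) (a1 : k1) (y : g0),
        pi y (rk x1 a1) + rk x1 (lam y a1) = rk (br10 g x1 y) a1,
      forall (a1 : k1) (y : g0),
        pi y (sq k a1) + br11 k a1 (lam y a1) = rk (lamt y a1) a1
    & forall (x1 : g1) (b : k0),
        pi (sq g x1) b = rk x1 (mut b x1)].

Definition condE : Prop :=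
  [/\ forall (x1 y : g1) (a1 : k1),
        mut (rk x1 a1) y = lam (br11 g x1 y) a1 + mut (rk y a1) x1,
      forall (y : g1) (a1 : k1),
        mut (sq k a1) y = br01 k (rk y a1) a1 + lam (rg y a1) a1,
      forall (x1 : g1) (b : k1),
        lam (sq g x1) b = mut (rk x1 b) x1
    & forall (x1 : g1) (a1 b : k1),
        lam (rg x1 a1) b
        = br01 k (rk x1 a1) b + lam (rg x1 b) a1 + mut (br11 k a1 b) x1
          + br01 k (rk x1 b) a1].

Definition condF : Prop :=
  [/\ forall (x1 : g1) (a1 b : k1),
        lamt (rg x1 a1) b = mu (br11 k a1 b) x1 + lamt (rg x1 b) a1,
      forall (x1 : g1) (b : k1),
        lamt (sq g x1) b = br01 g (rg x1 b) x1 + mu (rk x1 b) x1,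
      forall (y : g1) (a1 : k1),
        mu (sq k a1) y = lamt (rg y a1) a1
    & forall (x1 y : g1) (a1 : k1),
        mu (rk x1 a1) y
        = br01 g (rg x1 a1) y + mu (rk y a1) x1 + lamt (br11 g x1 y) a1
          + br01 g (rg y a1) x1].

End Conditions.

(* Main.v *)
Require Import Defs.
From HB Require Import structures.
From mathcomp Require Import all_boot all_order all_algebra.

(** The sum of g and k is a bicrossed product: each of its operations is the
    operation of g plus cross terms in the g-component, and the same expression
    with g and k exchanged in the k-component.  The exchange swaps pi with rho,
    lam with mu, lamt with mut, and rg with rk (arguments flipped).  It
    preserves (A) and (B), and turns (C) into (D) and (F) into (E).  Hence each
    axiom needs a proof only in the g-component; the k-component is the same
    lemma applied to the exchanged data.

    In the g-component, an axiom expands by multilinearity into a sum over the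
    ways of choosing, for each argument, its part in g or its part in k.  The
    terms with all arguments in g add up to zero by the axiom of g, and each of
    the other groups does so by a representation property or by one of (A)-(F):
    the Jacobi identity ([cross_bracket_jacobi]) uses rho and (A), the module
    axiom ([cross_act_repr]) uses mu and (B), and the axiom relating the square
    of v to the double bracket with v uses (C) on even elements
    ([cross_sq_even]) and (F) on odd elements ([cross_sq_odd]).
    Since signs disappear in characteristic 2, each such proof adds the relevant
    relations to the difference of the two sides and checks that every monomial
    then occurs an even number of times. *)

Set Implicit Arguments.
Unset Strict Implicit.
Unset Printing Implicit Defensive.

Import GRing.Theory.
Local Open Scope ring_scope.

(** * Linear combinations in characteristic 2 *)

Section CharTwoModule.
Context (K : fieldType) (char2 : 2%N \in [pchar K]) (V : lmodType K).
Implicit Types u v w : V.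

Lemma addvv_char2 v : v + v = 0.
Proof. by rewrite -[v]scale1r -scalerDl addrr_pchar2 // scale0r. Qed.

Lemma oppv_char2 v : - v = v.
Proof. by apply/eqP; rewrite eq_sym -subr_eq0 opprK addvv_char2. Qed.

Lemma addvKv_char2 u v : u + (u + v) = v.
Proof. by rewrite addrA addvv_char2 add0r. Qed.

Lemma eq_char2 u v : u + v = 0 -> u = v.
Proof. by move/eqP; rewrite addr_eq0 oppv_char2 => /eqP. Qed.

Lemma add_relation_char2 u v w : v = w -> u + (v + w) = 0 -> u = 0.
Proof. by move=> ->; rewrite addvv_char2 addr0. Qed.

End CharTwoModule.

Ltac sum_to_zero char2 := apply: (eq_char2 char2).

Ltac add_relation char2 e := apply: (add_relation_char2 char2 e).

(** Proves a sum to be zero when every monomial occurs an even number of times: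
    a second copy of the first monomial is moved leftwards until it cancels. *)
Ltac cancel_pairs char2 :=
  (* With a trailing 0, no monomial is the last summand, so that a single
     pattern finds the copy wherever it stands. *)
  match goal with |- ?s = 0 => rewrite -[s]addr0 -?addrA end;
  repeat match goal with
  | |- 0 = 0 => reflexivity
  | |- ?u + (?u + ?t) = 0 => rewrite (addvKv_char2 char2 u t)
  | |- ?u + ?s = 0 =>
      match s with context [?v + (u + ?t)] => rewrite (addrCA v u t) end
  end.

(** * Lie superalgebras in characteristic 2 *)

Section Superalgebra.
Context (K : fieldType) (char2 : 2%N \in [pchar K]).
Context (V0 V1 : lmodType K) (g : lie_superalgebra2 V0 V1).

Lemma br00C x y : br00 g x y = br00 g y x.
Proof.
sum_to_zero char2; have := lsa_bracket_alt g (x + y).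
by rewrite linearDl !linearDr /= !lsa_bracket_alt addr0 add0r.
Qed.

Lemma br11_linearl c x x' y :
  br11 g (c *: x + x') y = c *: br11 g x y + br11 g x' y.
Proof. exact: (lsa_polar_bilinear g).1. Qed.

Lemma br11_linearr c x y y' :
  br11 g x (c *: y + y') = c *: br11 g x y + br11 g x y'.
Proof. exact: (lsa_polar_bilinear g).2. Qed.

Lemma br11Dr x y z : br11 g x (y + z) = br11 g x y + br11 g x z.
Proof. by rewrite -[y]scale1r br11_linearr !scale1r. Qed.

Lemma sqD x y : sq g (x + y) = br11 g x y + sq g y + sq g x.
Proof. by rewrite /br11 /polar !subrK. Qed.

Lemma lie_repr_char2 (M : lmodType K) (b : V0 -> V0 -> V0) (f : V0 -> M -> M) :
  lie_repr b f -> forall x y m, f (b x y) m = f x (f y m) + f y (f x m).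
Proof. by move=> fP x y m; rewrite fP (oppv_char2 char2). Qed.

End Superalgebra.

(** * One component of the operations on the sum *)

Section Components.
Context (K : fieldType) (g0 g1 k0 k1 : lmodType K).
Context (g : lie_superalgebra2 g0 g1).
Context (rho : {bilinear k0 -> g0 -> g0}) (mu : {bilinear k0 -> g1 -> g1}).
Context (lamt : {bilinear g0 -> k1 -> g1}) (rg : {bilinear g1 -> k1 -> g0}).

(** The parts in g and in k are separate arguments, and those in g come first:
    the k-component is then the same definition for the exchanged data. *)
Definition cross_bracket (x : g0) (a : k0) (y : g0) (b : k0) : g0 :=
  br00 g x y + rho b x + rho a y.

Definition cross_act (x : g0) (a : k0) (m : g1) (n : k1) : g1 :=
  br01 g x m + mu a m + lamt x n.

Definition cross_sq (m : g1) (n : k1) : g0 := sq g m + rg m n.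

Definition cross_polar (m : g1) (n : k1) (m' : g1) (n' : k1) : g0 :=
  br11 g m m' + rg m n' + rg m' n.

Lemma cross_bracket_linearl c x a x' a' y b :
  cross_bracket (c *: x + x') (c *: a + a') y b
  = c *: cross_bracket x a y b + cross_bracket x' a' y b.
Proof.
rewrite /cross_bracket /br00 !(linearPl, linearPr) /= !scalerDr.
by rewrite [LHS](AC (2*2*2) ((1*3*5)*(2*4*6))).
Qed.

Lemma cross_bracket_linearr c x a y b y' b' :
  cross_bracket x a (c *: y + y') (c *: b + b')
  = c *: cross_bracket x a y b + cross_bracket x a y' b'.
Proof.
rewrite /cross_bracket /br00 !(linearPl, linearPr) /= !scalerDr.
by rewrite [LHS](AC (2*2*2) ((1*3*5)*(2*4*6))).
Qed.

Lemma cross_act_linearl c x a x' a' m n :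
  cross_act (c *: x + x') (c *: a + a') m n
  = c *: cross_act x a m n + cross_act x' a' m n.
Proof.
rewrite /cross_act /br01 !(linearPl, linearPr) /= !scalerDr.
by rewrite [LHS](AC (2*2*2) ((1*3*5)*(2*4*6))).
Qed.

Lemma cross_act_linearr c x a m n m' n' :
  cross_act x a (c *: m + m') (c *: n + n')
  = c *: cross_act x a m n + cross_act x a m' n'.
Proof.
rewrite /cross_act /br01 !(linearPl, linearPr) /= !scalerDr.
by rewrite [LHS](AC (2*2*2) ((1*3*5)*(2*4*6))).
Qed.

Lemma cross_polar_linearl c m n m' n' p q :
  cross_polar (c *: m + m') (c *: n + n') p q
  = c *: cross_polar m n p q + cross_polar m' n' p q.
Proof.
rewrite /cross_polar br11_linearl !(linearPl, linearPr) /= !scalerDr.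
by rewrite [LHS](AC (2*2*2) ((1*3*5)*(2*4*6))).
Qed.

Lemma cross_polar_linearr c p q m n m' n' :
  cross_polar p q (c *: m + m') (c *: n + n')
  = c *: cross_polar p q m n + cross_polar p q m' n'.
Proof.
rewrite /cross_polar br11_linearr !(linearPl, linearPr) /= !scalerDr.
by rewrite [LHS](AC (2*2*2) ((1*3*5)*(2*4*6))).
Qed.

Lemma cross_sqZ c m n : cross_sq (c *: m) (c *: n) = c ^+ 2 *: cross_sq m n.
Proof.
rewrite /cross_sq /sq lsa_sqZ linearZl linearZr /= scalerA -expr2.
by rewrite scalerDr.
Qed.

Section CharTwo.
Context (char2 : 2%N \in [pchar K]).

Lemma cross_bracket_alt x a : cross_bracket x a x a = 0.
Proof.
by rewrite /cross_bracket /br00 lsa_bracket_alt add0r (addvv_char2 char2).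
Qed.

Lemma cross_sq_polar m n m' n' :
  cross_sq (m + m') (n + n') - cross_sq m n - cross_sq m' n'
  = cross_polar m n m' n'.
Proof.
rewrite /cross_sq /cross_polar sqD linearDl !linearDr /=.
by rewrite !(oppv_char2 char2); sum_to_zero char2; cancel_pairs char2.
Qed.

End CharTwo.

End Components.

(** * The axioms in one component *)

Section Identities.
Context (K : fieldType) (char2 : 2%N \in [pchar K]).
Context (g0 g1 k0 k1 : lmodType K).
Context (g : lie_superalgebra2 g0 g1) (k : lie_superalgebra2 k0 k1).
Context (pi : {bilinear g0 -> k0 -> k0}) (lam : {bilinear g0 -> k1 -> k1}).
Context (rho : {bilinear k0 -> g0 -> g0}) (mu : {bilinear k0 -> g1 -> g1}).
Context (lamt : {bilinear g0 -> k1 -> g1}) (mut : {bilinear k0 -> g1 -> k1}).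
Context (rg : {bilinear g1 -> k1 -> g0}) (rk : {bilinear g1 -> k1 -> k0}).

Local Notation bracket_g := (cross_bracket g rho).
Local Notation bracket_k := (cross_bracket k pi).
Local Notation act_g := (cross_act g mu lamt).
Local Notation act_k := (cross_act k lam mut).

(** The terms with two arguments in g and one in k cancel by (A), once for each
    position of the latter; those with one argument in g cancel because rho is
    a representation. *)
Lemma cross_bracket_jacobi x y z a b c :
  lie_repr (br00 k) rho -> condA g k pi rho ->
  bracket_g x a (bracket_g y b z c) (bracket_k b y c z)
  + bracket_g y b (bracket_g z c x a) (bracket_k c z a x)
  + bracket_g z c (bracket_g x a y b) (bracket_k a x b y) = 0.
Proof.
move=> /(lie_repr_char2 char2) rhoP [A _].
have br00Dr u v w : br00 g u (v + w) = br00 g u v + br00 g u w.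
  exact: linearDr.
rewrite /cross_bracket !(br00Dr, linearDl, linearDr) /= !rhoP.
add_relation char2 (lsa_bracket_jacobi g x y z).
add_relation char2 (A y z a).
add_relation char2 (A z x b).
add_relation char2 (A x y c).
rewrite -!/(br00 g _ _) addr0.
(* The expansion and (A) have these brackets in opposite orders. *)
rewrite (br00C char2 g (rho a y)) (br00C char2 g (rho b z)).
rewrite (br00C char2 g (rho c x)).
by cancel_pairs char2.
Qed.

(** The terms are grouped by which of the three arguments lie in k: when both
    even arguments do, mu is a representation; every mixed group is one of the
    identities (B) with values in g, used twice if it is not symmetric in the
    two even arguments. *)
Lemma cross_act_repr x y a b m n :
  lie_repr (br00 k) mu -> condB g k pi lam rho mu lamt mut ->
  act_g (bracket_g x a y b) (bracket_k a x b y) m n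
  = act_g x a (act_g y b m n) (act_k b y n m)
    - act_g y b (act_g x a m n) (act_k a x n m).
Proof.
move=> /(lie_repr_char2 char2) muP [B1 _ [B3 _ B5 _]].
have br01Dl u v w : br01 g (u + v) w = br01 g u w + br01 g v w.
  exact: linearDl.
have br01Dr u v w : br01 g u (v + w) = br01 g u v + br01 g u w.
  exact: linearDr.
rewrite (oppv_char2 char2); sum_to_zero char2.
rewrite /cross_act /cross_bracket.
rewrite !(br01Dl, br01Dr, linearDl, linearDr) /= !muP.
add_relation char2 (lie_repr_char2 char2 (lsa_act_repr g) x y m).
add_relation char2 (B1 x b m).
add_relation char2 (B1 y a m).
add_relation char2 (B3 x b n).
add_relation char2 (B3 y a n).
add_relation char2 (B5 x y n).
rewrite -!/(br00 g _ _) -!/(br01 g _ _).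
by cancel_pairs char2.
Qed.

(** Beside the axiom of g, which is the part in m and y alone, the identities (C)
    are the homogeneous parts of this relation: the first two are linear in both
    m and n, with even argument y or b, the third is quadratic in m, and the
    last is quadratic in n. *)
Lemma cross_sq_even m n y b :
  condC g k lam rho mu lamt mut rg rk ->
  bracket_g (cross_sq g rg m n) (sq k n + rk m n) y b
  = cross_polar g rg m n (act_g y b m n) (act_k b y n m).
Proof.
case=> C1 C2 C3 C4; sum_to_zero char2.
have br00Dl u v w : br00 g (u + v) w = br00 g u w + br00 g v w.
  exact: linearDl.
rewrite /cross_bracket /cross_sq /cross_polar /cross_act.
rewrite !(br00Dl, br11Dr, linearDl, linearDr) /=.
add_relation char2 (lsa_sq_even g m y).
add_relation char2 (C1 m n y).
add_relation char2 (C2 m n b).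
add_relation char2 (C3 m b).
add_relation char2 (C4 n y).
rewrite /br10 -!/(br00 g _ _) -!/(br01 _ _ _) -!/(br11 g _ _) -!/(sq g _).
by cancel_pairs char2.
Qed.

(** As for [cross_sq_even], with the odd element (p, q) in place of (y, b) and
    (F) in place of (C). *)
Lemma cross_sq_odd m n p q :
  condF g k mu lamt rg rk ->
  act_g (cross_sq g rg m n) (sq k n + rk m n) p q
  = act_g (cross_polar g rg m n p q) (br11 k n q + rk p n + rk m q) m n.
Proof.
case=> F1 F2 F3 F4; sum_to_zero char2.
have br01Dl u v w : br01 g (u + v) w = br01 g u w + br01 g v w.
  exact: linearDl.
have sqP : br01 g (sq g m) p = br01 g (br11 g m p) m by exact: lsa_sq_odd.
rewrite /cross_sq /cross_polar /cross_act.
(* Brackets of odd elements unfold to sums of squares, which the additivity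
   lemmas would expand; they are generalized to remain monomials. *)
move: sqP (F1 m n q) (F4 m p n); move: (br11 g m p) (br11 k n q).
move=> mp nq sqP F1nq F4mp; rewrite !(br01Dl, linearDl, linearDr) /=.
add_relation char2 sqP.
add_relation char2 F1nq.
add_relation char2 (F2 m q).
add_relation char2 (F3 p n).
add_relation char2 F4mp.
by cancel_pairs char2.
Qed.

End Identities.

(** * Exchanging the two superalgebras *)

Section Flip.
Context (K : fieldType) (U V W : lmodType K) (f : {bilinear U -> V -> W}).

Definition flip_bilinear (v : V) (u : U) : W := f u v.

Lemma flip_is_bilinear : bilinear_for *:%R *:%R flip_bilinear.
Proof.
by split=> z c x y; rewrite /flip_bilinear ?linearPl ?linearPr.
Qed.

HB.instance Definition _ :=
  bilinear_isBilinear.Build K V U W *:%R *:%R flip_bilinear flip_is_bilinear.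

End Flip.

Section Exchange.
Context (K : fieldType) (g0 g1 k0 k1 : lmodType K).
Context (g : lie_superalgebra2 g0 g1) (k : lie_superalgebra2 k0 k1).
Context (pi : {bilinear g0 -> k0 -> k0}) (lam : {bilinear g0 -> k1 -> k1}).
Context (rho : {bilinear k0 -> g0 -> g0}) (mu : {bilinear k0 -> g1 -> g1}).
Context (lamt : {bilinear g0 -> k1 -> g1}) (mut : {bilinear k0 -> g1 -> k1}).
Context (rg : {bilinear g1 -> k1 -> g0}) (rk : {bilinear g1 -> k1 -> k0}).

Lemma condA_exchange : condA g k pi rho -> condA k g rho pi.
Proof. by case=> Ag Ak; split=> *; [exact: Ak | exact: Ag]. Qed.

Lemma condB_exchange :
  condB g k pi lam rho mu lamt mut -> condB k g rho mu pi lam mut lamt.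
Proof. by case=> ? ? [? ? ? ?]; do ![split]. Qed.

Lemma condD_exchange :
  condD g k pi lam mu lamt mut rg rk ->
  condC k g mu pi lam mut lamt (flip_bilinear rk) (flip_bilinear rg).
Proof.
by case=> D1 D2 D3 D4; split=> *; [exact: D1|exact: D2|exact: D3|exact: D4].
Qed.

Lemma condE_exchange :
  condE g k lam mut rg rk ->
  condF k g lam mut (flip_bilinear rk) (flip_bilinear rg).
Proof.
by case=> E1 E2 E3 E4; split=> *; [exact: E1|exact: E2|exact: E3|exact: E4].
Qed.

End Exchange.

(** * The bicrossed product *)

Section BicrossedProduct.
Context (K : fieldType) (char2 : 2%N \in [pchar K]).
Context (g0 g1 k0 k1 : lmodType K).
Context (g : lie_superalgebra2 g0 g1) (k : lie_superalgebra2 k0 k1).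
Context (pi : {bilinear g0 -> k0 -> k0}) (lam : {bilinear g0 -> k1 -> k1}).
Context (rho : {bilinear k0 -> g0 -> g0}) (mu : {bilinear k0 -> g1 -> g1}).
Context (lamt : {bilinear g0 -> k1 -> g1}) (mut : {bilinear k0 -> g1 -> k1}).
Context (rg : {bilinear g1 -> k1 -> g0}) (rk : {bilinear g1 -> k1 -> k0}).

Definition sum_bracket (p q : g0 * k0) : g0 * k0 :=
  (cross_bracket g rho p.1 p.2 q.1 q.2, cross_bracket k pi p.2 p.1 q.2 q.1).

Definition sum_act (p : g0 * k0) (v : g1 * k1) : g1 * k1 :=
  (cross_act g mu lamt p.1 p.2 v.1 v.2, cross_act k lam mut p.2 p.1 v.2 v.1).

Definition sum_sq (v : g1 * k1) : g0 * k0 :=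
  (cross_sq g rg v.1 v.2, cross_sq k (flip_bilinear rk) v.2 v.1).

Lemma sum_bracket_is_bilinear : bilinear_for *:%R *:%R sum_bracket.
Proof.
by split=> q c p p'; congr pair;
  rewrite /= ?cross_bracket_linearl ?cross_bracket_linearr.
Qed.

HB.instance Definition _ :=
  bilinear_isBilinear.Build K _ _ _ *:%R *:%R sum_bracket
    sum_bracket_is_bilinear.

Lemma sum_act_is_bilinear : bilinear_for *:%R *:%R sum_act.
Proof.
by split=> q c p p'; congr pair;
  rewrite /= ?cross_act_linearl ?cross_act_linearr.
Qed.

HB.instance Definition _ :=
  bilinear_isBilinear.Build K _ _ _ *:%R *:%R sum_act sum_act_is_bilinear.

Lemma sum_sq_polarE v w :
  polar sum_sq v w
  = (cross_polar g rg v.1 v.2 w.1 w.2,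
     cross_polar k (flip_bilinear rk) v.2 v.1 w.2 w.1).
Proof. by congr pair; rewrite -cross_sq_polar. Qed.

Lemma sum_sq_polar_is_bilinear : bilinear_for *:%R *:%R (polar sum_sq).
Proof.
by split=> w c v v'; rewrite /= !sum_sq_polarE; congr pair;
  rewrite /= ?cross_polar_linearl ?cross_polar_linearr.
Qed.

Lemma sum_sqZ c v : sum_sq (c *: v) = c ^+ 2 *: sum_sq v.
Proof. by congr pair; exact: cross_sqZ. Qed.

Lemma sum_bracket_alt p : sum_bracket p p = 0.
Proof. by congr pair; exact: cross_bracket_alt. Qed.

Context (pi_repr : lie_repr (br00 g) pi) (lam_repr : lie_repr (br00 g) lam).
Context (rho_repr : lie_repr (br00 k) rho) (mu_repr : lie_repr (br00 k) mu).
Context (hA : condA g k pi rho) (hB : condB g k pi lam rho mu lamt mut).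
Context (hC : condC g k lam rho mu lamt mut rg rk).
Context (hD : condD g k pi lam mu lamt mut rg rk).
Context (hE : condE g k lam mut rg rk) (hF : condF g k mu lamt rg rk).

Lemma sum_bracket_jacobi p q r :
  sum_bracket p (sum_bracket q r) + sum_bracket q (sum_bracket r p)
  + sum_bracket r (sum_bracket p q) = 0.
Proof.
congr pair; first exact: cross_bracket_jacobi.
exact: (cross_bracket_jacobi char2 _ _ _ _ _ _ pi_repr (condA_exchange hA)).
Qed.

Lemma sum_act_repr : lie_repr sum_bracket sum_act.
Proof.
move=> p q v; congr pair.
  exact: (cross_act_repr char2 _ _ _ _ _ _ mu_repr hB).
exact: (cross_act_repr char2 _ _ _ _ _ _ lam_repr (condB_exchange hB)).
Qed.

Lemma sum_sq_even v p :
  sum_bracket (sum_sq v) p = polar sum_sq v (sum_act p v).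
Proof.
rewrite sum_sq_polarE; congr pair.
  exact: (cross_sq_even char2 _ _ _ _ hC).
exact: (cross_sq_even char2 _ _ _ _ (condD_exchange hD)).
Qed.

Lemma sum_sq_odd v w :
  sum_act (sum_sq v) w = sum_act (polar sum_sq v w) v.
Proof.
rewrite sum_sq_polarE; congr pair.
  exact: (cross_sq_odd char2 _ _ _ _ hF).
exact: (cross_sq_odd char2 _ _ _ _ (condE_exchange hE)).
Qed.

Definition bicrossed_product :
    lie_superalgebra2 (g0 * k0)%type (g1 * k1)%type :=
  LieSuperalgebra2 sum_bracket_alt sum_bracket_jacobi sum_act_repr sum_sqZ
    sum_sq_polar_is_bilinear sum_sq_even sum_sq_odd.

End BicrossedProduct.

Theorem theorem3p5p1
  (K : fieldType) (char2 : 2%N \in [pchar K])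
  (g0 g1 k0 k1 : lmodType K)
  (g : lie_superalgebra2 g0 g1) (k : lie_superalgebra2 k0 k1)
  (pi : {bilinear g0 -> k0 -> k0}) (lam : {bilinear g0 -> k1 -> k1})
  (rho : {bilinear k0 -> g0 -> g0}) (mu : {bilinear k0 -> g1 -> g1})
  (lamt : {bilinear g0 -> k1 -> g1}) (mut : {bilinear k0 -> g1 -> k1})
  (rg : {bilinear g1 -> k1 -> g0}) (rk : {bilinear g1 -> k1 -> k0})
  (pi_repr : lie_repr (br00 g) pi) (lam_repr : lie_repr (br00 g) lam)
  (rho_repr : lie_repr (br00 k) rho) (mu_repr : lie_repr (br00 k) mu)
  (hA : condA g k pi rho)
  (hB : condB g k pi lam rho mu lamt mut)
  (hC : condC g k lam rho mu lamt mut rg rk)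
  (hD : condD g k pi lam mu lamt mut rg rk)
  (hE : condE g k lam mut rg rk)
  (hF : condF g k mu lamt rg rk) :
  exists h : lie_superalgebra2 (g0 * k0)%type (g1 * k1)%type,
    [/\ forall (x0 y0 : g0) (a0 b0 : k0),
          br00 h (x0, a0) (y0, b0)
          = (br00 g x0 y0 + rho b0 x0 + rho a0 y0,
             br00 k a0 b0 + pi x0 b0 + pi y0 a0),
        forall (x0 : g0) (x1 : g1) (a0 : k0) (a1 : k1),
          br01 h (x0, a0) (x1, a1)
          = (br01 g x0 x1 + mu a0 x1 + lamt x0 a1,
             br01 k a0 a1 + lam x0 a1 + mut a0 x1)
      & forall (x1 : g1) (a1 : k1),
          sq h (x1, a1)
          = (sq g x1 + rg x1 a1, sq k a1 + rk x1 a1)].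
Proof.
exists (bicrossed_product char2 pi_repr lam_repr rho_repr mu_repr
          hA hB hC hD hE hF).
split=> // x0 y0 a0 b0; congr pair.
(* Exchanging g and k also exchanges the two cross terms of the bracket. *)
by rewrite [RHS]addrAC.
Qed.
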